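(* Let $H\in\mathbb{R}^{m\times p}$, $S_0\in\mathbb{R}^{p\times n}$, $L_0\in\mathbb{R}^{m\times n}$, and $M_0=HS_0+L_0$. Let $H=U_H\Sigma_HV_H^\top$ be a reduced singular value decomposition of $H$, and set $C=U_H\Sigma_H^{-1}U_H^\top\in\mathbb{R}^{m\times m}$ and $\tilde H=CH=U_HV_H^\top\in\mathbb{R}^{m\times p}$. Suppose there exists $\delta<1/3$ such that $$\|P_{\ker(H)}A\|_\infty\le\delta\|A\|_\infty\quad\text{for all }A\in\Omega(S_0)$$ and $$\mu_{\tilde H}(S_0)\,\xi_{\tilde H}(CL_0)<\frac{1-3\delta}{6}.$$ Then there exists $\gamma>0$ such that for every optimizer $(\hat S_c,\hat Y)$ of $$\min_{S\in\mathbb{R}^{p\times n},\,Y\in\mathbb{R}^{m\times n}}\ \gamma\|S\|_1+\|Y\|_*\quad\text{subject to}\quad Y+\tilde HS=CM_0,$$ with $\hat L_c:=M_0-H\hat S_c$, we have $\hat S_c=S_0$ and $\hat L_c=L_0$.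
   Context: Norms of a real matrix $X=(x_{ij})$: $\|X\|_1=\sum_{i,j}|x_{ij}|$ and $\|X\|_\infty=\max_{i,j}|x_{ij}|$ (both entrywise), $\|X\|_*$ is the nuclear norm (sum of singular values), and $\|X\|$ is the spectral norm (largest singular value). Reduced SVD: $U_H\in\mathbb{R}^{m\times \mathrm{rank}(H)}$ and $V_H\in\mathbb{R}^{p\times\mathrm{rank}(H)}$ have orthonormal columns, and $\Sigma_H$ is the square diagonal matrix of the positive singular values of $H$. $P_{\ker(H)}\in\mathbb{R}^{p\times p}$ denotes the orthogonal projection onto the kernel of $H$; $P_{\ker(H)}A$ is the matrix product. $\Omega(S_0)$ is the set of all $p\times n$ real matrices whose support (set of positions of nonzero entries) is contained in the support of $S_0$. For a matrix $G\in\mathbb{R}^{m\times p}$, $S\in\mathbb{R}^{p\times n}$ and $L\in\mathbb{R}^{m\times n}$ define $$\mu_G(S):=\max_{A\in\Omega(S),\ \|A\|_\infty\le1}\|GA\|,\qquad \xi_G(L):=\max_{B\in\mathcal{T}(L),\ \|B\|\le1}\|G^\top B\|_\infty,$$ where $\mathcal{T}(L)$ is the tangent space at $L$ to the variety of all $m\times n$ real matrices of rank at most $\mathrm{rank}(L)$. Explicitly, if $L=U\Sigma V^\top$ is a reduced SVD with $r=\mathrm{rank}(L)$, then $\mathcal{T}(L)=\{UX^\top+YV^\top: X\in\mathbb{R}^{n\times r},\ Y\in\mathbb{R}^{m\times r}\}$ (and $\mathcal{T}(0)=\{0\}$). *)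

(* Defs.v *)
From mathcomp Require Import all_boot all_order all_algebra.
From mathcomp Require Import polyrcf.
From mathcomp Require Import boolp classical_sets reals matrix_normedtype.

Set Implicit Arguments.
Unset Strict Implicit.
Unset Printing Implicit Defensive.
Import Order.TTheory GRing.Theory Num.Theory.
Local Open Scope classical_set_scope.
Local Open Scope ring_scope.

(* Square roots of the eigenvalues of X^T X, repeated with multiplicity.  The
   list has n entries, so it may contain more than minn m n of them: the extra
   ones are zeros, which affect neither their sum nor their maximum. *)
Definition singular_values (R : rcfType) (m n : nat) (X : 'M[R]_(m, n)) : seq R :=
  let p := char_poly (X^T *m X) in
  flatten [seq nseq (mup x p) (Num.sqrt x) | x <- rootsR p].

Definition nuclear_norm (R : rcfType) (m n : nat) (X : 'M[R]_(m, n)) : R :=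
  \sum_(s <- singular_values X) s.

Definition spectral_norm (R : rcfType) (m n : nat) (X : 'M[R]_(m, n)) : R :=
  \big[Num.max/0]_(s <- singular_values X) s.

Definition norm1 (R : rcfType) (m n : nat) (X : 'M[R]_(m, n)) : R :=
  \sum_(i < m) \sum_(j < n) `|X i j|.

(* mx_norm is the entrywise maximum norm, defined for all dimensions. *)
Definition norm_max (R : rcfType) (m n : nat) (X : 'M[R]_(m, n)) : R := mx_norm X.

Definition reduced_svd (R : rcfType) (m n : nat) (X : 'M[R]_(m, n))
    (U : 'M[R]_(m, \rank X)) (Sigma : 'M[R]_(\rank X)) (V : 'M[R]_(n, \rank X)) : Prop :=
  [/\ U^T *m U = 1%:M, V^T *m V = 1%:M,
      is_diag_mx Sigma /\ (forall i, 0 < Sigma i i)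
    & X = U *m Sigma *m V^T].
Arguments reduced_svd {R m n} X U Sigma V.

(* Orthogonal projection of column vectors onto {v | H v = 0}.  MathComp's
   kernels and projections act on row vectors, hence the transpositions:
   proj_mx K (kermx K^T) projects onto the row space of K along its
   orthogonal complement. *)
Definition ker_proj (R : rcfType) (m p : nat) (H : 'M[R]_(m, p)) : 'M[R]_p :=
  let K := kermx H^T in (proj_mx K (kermx K^T))^T.

Definition Omega (R : rcfType) (p n : nat) (S : 'M[R]_(p, n)) : set 'M[R]_(p, n) :=
  [set A | forall i j, A i j != 0 -> S i j != 0].

(* The space does not depend on the choice of the reduced SVD. *)
Definition tangent_space (R : rcfType) (m n : nat) (L : 'M[R]_(m, n)) :
    set 'M[R]_(m, n) :=
  [set B | exists U Sigma V, reduced_svd L U Sigma V /\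
     exists (X : 'M[R]_(n, \rank L)) (Y : 'M[R]_(m, \rank L)),
       B = U *m X^T + Y *m V^T].

(* The maxima in mu and xi are over nonempty sets of reals on which they are
   attained, so they are the suprema. *)
Definition mu (R : realType) (m p n : nat) (G : 'M[R]_(m, p)) (S : 'M[R]_(p, n)) : R :=
  sup [set spectral_norm (G *m A) | A in [set A | Omega S A /\ norm_max A <= 1]].

Definition xi (R : realType) (m p n : nat) (G : 'M[R]_(m, p)) (L : 'M[R]_(m, n)) : R :=
  sup [set norm_max (G^T *m B) |
       B in [set B | tangent_space L B /\ spectral_norm B <= 1]].

(* (S, Y) is a minimizer of gamma * |S|_1 + |Y|_* subject to Y + G S = N. *)
Definition optimizer (R : rcfType) (m p n : nat) (gamma : R) (G : 'M[R]_(m, p))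
    (N : 'M[R]_(m, n)) (S : 'M[R]_(p, n)) (Y : 'M[R]_(m, n)) : Prop :=
  Y + G *m S = N /\
  forall (S' : 'M[R]_(p, n)) (Y' : 'M[R]_(m, n)), Y' + G *m S' = N ->
    gamma * norm1 S + nuclear_norm Y <= gamma * norm1 S' + nuclear_norm Y'.

(* Main.v *)
Require Import Defs.
From HB Require Import structures.
From mathcomp Require Import all_boot all_order all_algebra.
From mathcomp Require Import boolp classical_sets reals.
From mathcomp Require Import spectral polyrcf complex matrix_normedtype.
From mathcomp Require Import ring lra.
Import Order.TTheory GRing.Theory Num.Theory.
Local Open Scope ring_scope.

Set Implicit Arguments.
Unset Strict Implicit.

(** Write G = C H = U_H V_H^T and L = C L0, so that C M0 = L + G S0 and
    G^T G = 1 - P_ker(H).  Let L = U Sigma V^T be a reduced singular value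
    decomposition and let N be the orthogonal projection onto the complement of
    the tangent space T at L; explicitly N M = (1 - U U^T) M (1 - V V^T).  The
    fact that every optimizer equals (S0, L) is derived from a dual certificate.

    Optimality ([certificate_recovery]).  Suppose Q = U V^T + N Z with
    |Z| < 1, and G^T Q equals gamma sign(S0) on the support of S0 and is
    smaller than gamma in absolute value elsewhere.  Then |Q| <= 1, so by
    duality of the nuclear and spectral norms
    <Q, Y> + <G^T Q, S> <= |Y|_* + gamma |S|_1, with equality at (L, S0), while
    the left-hand side is <Q, Y + G S>, a constant on the feasible set.  Hence
    every optimizer (S, Y) has equality in both terms.  Strictness off the
    support puts S in Omega(S0), and strictness of |Z| < 1 puts Y in T.  So
    G (S - S0) = L - Y lies in T while S - S0 lies in Omega(S0), and it remains
    to know that G maps no nonzero element of Omega(S0) into T.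

    Transversality ([incoherent_transversal]).  If A is in Omega(S0) and G A is
    in T, then A = G^T (G A) + P_ker(H) A has maximum norm at most
    (mu xi + delta) |A|_max, which forces A = 0 since mu xi + delta < 1.

    Existence ([certificate_exists], [incoherent_certificate]).  Take Z = G A
    with A in Omega(S0).  The conditions on the support are a linear system for
    A whose operator, the compression of G^T N G to Omega(S0), is positive
    semidefinite; transversality makes it definite, hence invertible.  With
    a = |A|_max and k = mu xi, the equation
    A = G^T Q - G^T (U V^T) + P_ker(H) A + G^T (G A - N G A) and the bound
    |M - N M| <= 2 |M| give a <= gamma + xi + (2 k + delta) a, and the entries
    of G^T Q off the support are at most xi + (2 k + delta) a.  Both
    requirements, mu a < 1 and the strict bound by gamma off the support, follow
    when 3 xi < gamma and mu gamma < 1 - 3 k - delta, and 6 k + 3 delta < 1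
    with delta >= 0 leaves room for such a gamma.

    The norms enter only through the singular value decomposition
    ([svd_exists]), a consequence of the spectral theorem for real symmetric
    matrices ([symmetric_orthogonal_diag]).  It gives |L|_* = tr Sigma, the
    description of the spectral norm by the associated bilinear form
    ([spectral_norm_leP]), and the duality inequality
    ([frob_le_nuclear_norm]). *)

(** * Frobenius inner product *)

Definition frob (R : comPzRingType) (m n : nat) (A B : 'M[R]_(m, n)) : R :=
  \tr (A^T *m B).

Section Frobenius.
Variable R : realDomainType.

Lemma frobE (m n : nat) (A B : 'M[R]_(m, n)) :
  frob A B = \sum_i \sum_j A i j * B i j.
Proof.
rewrite /frob exchange_big; apply: eq_bigr => j _; rewrite mxE.
by apply: eq_bigr => i _; rewrite mxE.
Qed.

Lemma frobC (m n : nat) (A B : 'M[R]_(m, n)) : frob A B = frob B A.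
Proof. by rewrite /frob -mxtrace_tr trmx_mul trmxK. Qed.

Lemma frobDr (m n : nat) (A B C : 'M[R]_(m, n)) :
  frob A (B + C) = frob A B + frob A C.
Proof. by rewrite /frob mulmxDr mxtraceD. Qed.

Lemma frobDl (m n : nat) (A B C : 'M[R]_(m, n)) :
  frob (A + B) C = frob A C + frob B C.
Proof. by rewrite frobC frobDr !(frobC C). Qed.

Lemma frobZr (m n : nat) (a : R) (A B : 'M[R]_(m, n)) :
  frob A (a *: B) = a * frob A B.
Proof. by rewrite /frob -scalemxAr mxtraceZ. Qed.

Lemma frobZl (m n : nat) (a : R) (A B : 'M[R]_(m, n)) :
  frob (a *: A) B = a * frob A B.
Proof. by rewrite frobC frobZr frobC. Qed.

Lemma frobNr (m n : nat) (A B : 'M[R]_(m, n)) : frob A (- B) = - frob A B.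
Proof. by rewrite -scaleN1r frobZr mulN1r. Qed.

Lemma frob0r (m n : nat) (A : 'M[R]_(m, n)) : frob A 0 = 0.
Proof. by rewrite /frob mulmx0 mxtrace0. Qed.

Lemma frob_mull (m n p : nat) (G : 'M[R]_(m, p)) (A : 'M[R]_(p, n)) B :
  frob (G *m A) B = frob A (G^T *m B).
Proof. by rewrite /frob trmx_mul mulmxA. Qed.

Lemma frob_mulr (m n p : nat) (G : 'M[R]_(m, p)) A (B : 'M[R]_(p, n)) :
  frob A (G *m B) = frob (G^T *m A) B.
Proof. by rewrite frob_mull trmxK. Qed.

Lemma frob_mulrr (m n p : nat) (A : 'M[R]_(m, p)) (G : 'M[R]_(p, n)) B :
  frob (A *m G) B = frob A (B *m G^T).
Proof. by rewrite /frob trmx_mul -mulmxA mxtrace_mulC mulmxA. Qed.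

Lemma frob_ge0 (m n : nat) (A : 'M[R]_(m, n)) : 0 <= frob A A.
Proof.
by rewrite frobE; apply: sumr_ge0 => i _; apply: sumr_ge0 => j _; exact: sqr_ge0.
Qed.

Lemma frob_eq0 (m n : nat) (A : 'M[R]_(m, n)) : frob A A = 0 -> A = 0.
Proof.
rewrite frobE => /eqP; rewrite psumr_eq0 => [/allP /= A0|i _]; last first.
  by apply: sumr_ge0 => j _; exact: sqr_ge0.
apply/matrixP => i j; have /eqP/psumr_eq0P/(_ j isT)/eqP := A0 i (mem_index_enum _).
by rewrite mxE -expr2 sqrf_eq0 => /(_ (fun k _ => sqr_ge0 (A i k)))/eqP.
Qed.

End Frobenius.

(** * Diagonalization of real symmetric matrices *)

Section RealSpectral.
Variable R : rcfType.

(** Over the complex numbers there is an eigenvector x + i y with an eigenvalue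
    a + i b; symmetry gives b = 0, and then x or y is a real eigenvector. *)
Lemma symmetric_eigenvector (n : nat) (A : 'M[R]_n.+1) : A^T = A ->
  exists (a : R) (v : 'rV[R]_n.+1), v *m v^T = 1%:M /\ v *m A = a *: v.
Proof.
move=> symA; pose toC : {rmorphism R -> R[i]} := real_complex R.
have [[a b] /eigenvalueP[z zA z0]] := eigenvalue_closed (map_mx toC A) (ltn0Sn n).
pose x := map_mx (@complex.Re R) z; pose y := map_mx (@complex.Im R) z.
have ReM : map_mx (@complex.Re R) (z *m map_mx toC A) = x *m A.
  apply/rowP => j; rewrite !mxE (big_morph (@complex.Re R) (id1:=0) (op1:=+%R)) //.
    by apply: eq_bigr => k _; rewrite !mxE; case: (z _ _) => u v /=; rewrite mulr0 subr0.
  by move=> [? ?] [? ?].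
have ImM : map_mx (@complex.Im R) (z *m map_mx toC A) = y *m A.
  apply/rowP => j; rewrite !mxE (big_morph (@complex.Im R) (id1:=0) (op1:=+%R)) //.
    by apply: eq_bigr => k _; rewrite !mxE; case: (z _ _) => u v /=; rewrite mulr0 add0r.
  by move=> [? ?] [? ?].
have xA : x *m A = a *: x - b *: y.
  rewrite -ReM zA; apply/rowP => j; rewrite !mxE.
  by case: (z _ _) => u v.
have yA : y *m A = b *: x + a *: y.
  rewrite -ImM zA; apply/rowP => j; rewrite !mxE.
  by case: (z _ _) => u v /=; rewrite addrC.
have nz : frob x x + frob y y != 0.
  apply: contraNneq z0 => /eqP; rewrite paddr_eq0 ?frob_ge0//.
  move=> /andP[/eqP/frob_eq0 x0 /eqP/frob_eq0 y0].
  apply/eqP/rowP => j; move/rowP/(_ j): x0; move/rowP/(_ j): y0; rewrite !mxE.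
  by case: (z _ _) => u v /= -> ->.
(* Comparing x A y^T with y A x^T gives b (|x|^2 + |y|^2) = 0. *)
have b0 : b = 0.
  have : frob (x *m A) y = frob (y *m A) x.
    by rewrite frob_mulrr symA [RHS]frobC.
  rewrite xA yA -scaleN1r !frobDl !frobZl (frobC y x) => e.
  by apply: (mulIf nz); rewrite mul0r; move: e; lra.
have normalize (v : 'rV[R]_n.+1) : v *m A = a *: v -> frob v v != 0 ->
    exists (c : R) (u : 'rV[R]_n.+1), u *m u^T = 1%:M /\ u *m A = c *: u.
  move=> vA v0; exists a, ((Num.sqrt (frob v v))^-1 *: v); split; last first.
    by rewrite -scalemxAl vA !scalerA mulrC.
  rewrite linearZ /= -scalemxAl -scalemxAr scalerA [v *m _]mx11_scalar.
  have -> : (v *m v^T) 0 0 = frob v v by rewrite /frob mxtrace_mulC trace_mx11.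
  rewrite scale_scalar_mx -invfM -expr2 sqr_sqrtr ?frob_ge0// mulVf//.
have [x0|] := eqVneq (frob x x) 0; last by apply: normalize; rewrite xA b0 scale0r subr0.
apply: (normalize y); first by rewrite yA b0 scale0r add0r.
by rewrite x0 add0r in nz.
Qed.

(** A Householder reflection: [v] and the first basis vector [e] have the same
    length, so the reflection in the hyperplane orthogonal to [v - e] swaps
    them. *)
Lemma orthogonal_first_row (n : nat) (v : 'rV[R]_n.+1) : v *m v^T = 1%:M ->
  exists P : 'M[R]_n.+1, P *m P^T = 1%:M /\ row 0 P = v.
Proof.
move=> v1; pose e : 'rV[R]_n.+1 := delta_mx 0 0.
have [->|ve] := eqVneq v e.
  by exists 1%:M; rewrite trmx1 mulmx1 row1.
have [w wE] : exists w, w = v - e by exists (v - e).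
pose c := frob w w.
have c0 : c != 0 by apply: contraNneq ve => /frob_eq0/eqP; rewrite wE subr_eq0.
have fvv : frob v v = 1 by rewrite /frob mxtrace_mulC v1 mxtrace1.
have fev : frob e v = v 0 0.
  rewrite /frob mxtrace_mulC trace_mx11 /e trmx_delta mxE (bigD1 0)//= big1 ?addr0.
    by rewrite mxE !eqxx mulr1.
  by move=> i /negPf i0; rewrite mxE i0 mulr0.
have fee : frob e e = 1.
  by rewrite /frob mxtrace_mulC trace_mx11 /e trmx_delta mul_delta_mx mxE !eqxx.
have fwe : frob e w = v 0 0 - 1 by rewrite wE frobDr frobNr fev fee.
have cE : c = - 2 * (v 0 0 - 1).
  rewrite /c {1}wE frobDl -scaleN1r frobZl fwe wE frobDr frobNr fvv (frobC v) fev.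
  by ring.
have ww : w *m w^T = c%:M.
  by rewrite [LHS]mx11_scalar; congr _%:M; rewrite /c /frob mxtrace_mulC trace_mx11.
pose P : 'M[R]_n.+1 := 1%:M - (2 / c) *: (w^T *m w).
have PT : P^T = P by rewrite /P linearB /= linearZ /= trmx_mul trmxK trmx1.
exists P; split.
  rewrite PT /P mulmxBl mul1mx mulmxBr mulmx1 -!scalemxAl -!scalemxAr.
  rewrite -!mulmxA (mulmxA w) ww mul_scalar_mx -scalemxAr !scalerA.
  have -> : 2 / c * (2 / c * c) = 2 / c + 2 / c by field.
  by rewrite scalerDl opprB addrK subrK.
rewrite rowE -/e /P mulmxBr mulmx1 -scalemxAr mulmxA.
have -> : e *m w^T = (v 0 0 - 1)%:M.
  by rewrite [LHS]mx11_scalar; congr _%:M; rewrite -fwe frobC /frob mxtrace_mulC trace_mx11.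
rewrite mul_scalar_mx scalerA.
have -> : 2 / c * (v 0 0 - 1) = -1.
  by move: c0; rewrite cE mulf_eq0 negb_or => /andP[_ ?]; field.
by rewrite scaleN1r opprK wE addrC subrK.
Qed.

(** Spectral theorem.  In an orthonormal basis starting with a unit eigenvector,
    A is block diagonal with a 1 x 1 block, and symmetry passes to the other
    block. *)
Lemma symmetric_orthogonal_diag (n : nat) (A : 'M[R]_n) : A^T = A ->
  exists (P : 'M[R]_n) (d : 'rV[R]_n),
    P *m P^T = 1%:M /\ A = P^T *m diag_mx d *m P.
Proof.
elim: n A => [|n IHn] A symA.
  by exists 1%:M, 0; split; apply/matrixP => -[].
have [a [v [v1 vA]]] := symmetric_eigenvector symA.
have [P [P1 Pv]] := orthogonal_first_row v1.
pose B : 'M[R]_(1 + n) := P *m A *m P^T.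
have symB : B^T = B by rewrite /B !trmx_mul symA trmxK mulmxA.
have B0 : row 0 B = a *: delta_mx 0 0.
  rewrite /B !row_mul Pv vA -scalemxAl; congr (_ *: _).
  by rewrite -Pv -row_mul P1 row1.
have Bur : ursubmx B = 0.
  apply/matrixP => i j; rewrite !mxE ord1.
  have -> : lshift n 0 = 0 :> 'I_(1 + n) by apply/val_inj.
  by move/rowP/(_ (rshift 1 j)): B0; rewrite !mxE /= mulr0.
have Bul : ulsubmx B = a%:M.
  apply/matrixP => i j; rewrite !mxE !ord1.
  have -> : lshift n 0 = 0 :> 'I_(1 + n) by apply/val_inj.
  by move/rowP/(_ 0): B0; rewrite !mxE /= !mulr1.
have Bdl : dlsubmx B = 0.
  by rewrite -[LHS]trmxK trmx_dlsub symB Bur trmx0.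
have [P' [d [P'1 B'E]]] := IHn (drsubmx B) (etrans (trmx_drsub B) (congr1 drsubmx symB)).
pose Q : 'M[R]_(1 + n) := block_mx 1%:M 0 0 P'.
have Q1 : Q *m Q^T = 1%:M.
  rewrite /Q tr_block_mx mulmx_block !trmx0 !trmx1 !mulmx0 !mul0mx !mulmx1 !addr0 add0r.
  by rewrite P'1 -scalar_mx_block.
have PP : P^T *m P = 1%:M by apply/mulmx1C.
exists (Q *m P), (row_mx a%:M d); split.
  by rewrite trmx_mul mulmxA -(mulmxA Q) P1 mulmx1 Q1.
have BE : B = Q^T *m diag_mx (row_mx a%:M d) *m Q.
  rewrite diag_mx_row /Q tr_block_mx !mulmx_block !trmx0 trmx1 !mulmx0 !mul0mx !mul1mx.
  rewrite !mulmx1 !addr0 !add0r !mul0mx -B'E -[LHS]submxK Bur Bul Bdl; congr block_mx.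
  by apply/matrixP => i j; rewrite !ord1 !mxE.
rewrite trmx_mul !mulmxA -(mulmxA _ Q^T) -(mulmxA P^T) -BE.
by rewrite /B -!mulmxA PP mulmx1 mulmxA PP mul1mx.
Qed.

End RealSpectral.

(** * Singular value decomposition *)

Section SVD.
Variable R : rcfType.

Lemma char_poly_orthogonal_diag (n : nat) (P : 'M[R]_n) (d : 'rV[R]_n) :
  P *m P^T = 1%:M ->
  char_poly (P^T *m diag_mx d *m P) = \prod_i ('X - (d 0 i)%:P).
Proof.
move=> P1; have PP : P^T *m P = 1%:M by apply/mulmx1C.
have -> : \prod_i ('X - (d 0 i)%:P) = char_poly (diag_mx d).
  rewrite char_poly_trig ?diag_mx_is_trig//.
  by apply: eq_bigr => i _; rewrite mxE eqxx mulr1n.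
have PPC : map_mx polyC P^T *m map_mx polyC P = 1%:M by rewrite -map_mxM PP map_mx1.
rewrite /char_poly /char_poly_mx !map_mxM /=.
have -> : 'X%:M = map_mx polyC P^T *m 'X%:M *m map_mx polyC P.
  by rewrite mul_mx_scalar -scalemxAl PPC scalemx1.
rewrite -mulmxBl -mulmxBr !det_mulmx mulrAC -det_mulmx PPC det1 mul1r.
by rewrite mul_mx_scalar -scalemxAl PPC scalemx1.
Qed.

Lemma singular_values_perm (m n : nat) (X : 'M[R]_(m, n)) (s : seq R) :
  char_poly (X^T *m X) = \prod_(x <- s) ('X - x%:P) ->
  perm_eq (singular_values X) (map Num.sqrt s).
Proof.
rewrite /singular_values => ->; set p := \prod_(x <- s) _.
have p0 : p != 0 by rewrite monic_neq0// monic_prod_XsubC.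
have -> : flatten [seq nseq (mup x p) (Num.sqrt x) | x <- rootsR p] =
    map Num.sqrt (flatten [seq nseq (count_mem x s) x | x <- rootsR p]).
  rewrite map_flatten -map_comp; congr flatten; apply: eq_map => x /=.
  by rewrite map_nseq mu_prod_XsubC.
apply: perm_map; apply: perm_trans (perm_count_undup s).
apply/perm_flatten/perm_map/uniq_perm; rewrite ?undup_uniq ?uniq_roots// => x.
by rewrite -roots_on_rootsR// mem_undup -root_prod_XsubC in_itv.
Qed.

(** With X^T X = P^T diag(d) P, the columns of W = X P^T are orthogonal with
    squared lengths d_j.  Those with d_j = 0 vanish, and normalizing the others
    gives U.  The decomposition comes with the values of both norms because the
    eigenvalues d_j are at hand; the norms of an arbitrary decomposition of X
    would have to be computed separately. *)
Lemma svd_exists (m n : nat) (X : 'M[R]_(m, n)) :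
  exists U Sigma V, [/\ reduced_svd X U Sigma V, nuclear_norm X = \tr Sigma
    & forall c, 0 <= c -> spectral_norm X <= c <-> forall i, Sigma i i <= c].
Proof.
have [|P [d [P1 XE]]] := @symmetric_orthogonal_diag R n (X^T *m X).
  by rewrite trmx_mul trmxK.
have PP : P^T *m P = 1%:M by apply/mulmx1C.
have svX : perm_eq (singular_values X) [seq Num.sqrt (d 0 i) | i <- enum 'I_n].
  rewrite (map_comp Num.sqrt (d 0)); apply: singular_values_perm.
  by rewrite XE char_poly_orthogonal_diag// big_map big_enum.
pose W := X *m P^T; have WP : X = W *m P by rewrite /W -mulmxA PP mulmx1.
have WW : W^T *m W = diag_mx d.
  rewrite /W trmx_mul trmxK mulmxA -(mulmxA P) XE !mulmxA P1 mul1mx.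
  by rewrite -!mulmxA P1 mulmx1.
have dE j : d 0 j = \sum_i W i j ^+ 2.
  have /matrixP/(_ j j) := WW; rewrite !mxE eqxx mulr1n => <-.
  by apply: eq_bigr => i _; rewrite mxE.
have d_ge0 j : 0 <= d 0 j by rewrite dE sumr_ge0// => i _; exact: sqr_ge0.
have W0 i j : d 0 j = 0 -> W i j = 0.
  rewrite dE => /eqP; rewrite psumr_eq0 => [/allP/(_ i (mem_index_enum _))|k _].
    by rewrite sqrf_eq0 => /eqP.
  exact: sqr_ge0.
pose I := [pred j | d 0 j != 0].
have reindexI (F : 'I_n -> R) : (forall j, d 0 j = 0 -> F j = 0) ->
    \sum_j F j = \sum_(k < #|I|) F (enum_val k).
  move=> F0; rewrite -big_enum_val /= [LHS](bigID I) /= [X in _ + X]big1 ?addr0//.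
  by move=> j /negPn/eqP/F0.
pose e (k : 'I_#|I|) : 'I_n := enum_val k.
have e_inj : injective e by exact: enum_val_inj.
have e_pos k : 0 < Num.sqrt (d 0 (e k)).
  by rewrite sqrtr_gt0 lt_neqAle d_ge0 andbT eq_sym; exact: (enum_valP k).
pose s := \row_k Num.sqrt (d 0 (e k)); pose t := \row_k (Num.sqrt (d 0 (e k)))^-1.
pose V := (rowsub e P)^T; pose U := colsub e W *m diag_mx t.
have ts : diag_mx t *m diag_mx s = 1%:M.
  rewrite mulmx_diag -diag_const_mx; congr diag_mx; apply/rowP => k.
  by rewrite !mxE mulVf ?gt_eqF.
have UU : U^T *m U = 1%:M.
  apply/matrixP => i j; rewrite /U trmx_mul tr_diag_mx mulmxA -(mulmxA _ _ (colsub e W)).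
  rewrite mul_mx_diag mxE mul_diag_mx mxE.
  have -> : ((colsub e W)^T *m colsub e W) i j = (W^T *m W) (e i) (e j).
    by rewrite !mxE; apply: eq_bigr => k _; rewrite !mxE.
  rewrite WW !mxE (inj_eq e_inj); case: eqVneq => [->|_]; last by rewrite mulr0 mul0r.
  rewrite !mulr1n -{2}(sqr_sqrtr (d_ge0 (e j))).
  by rewrite expr2 mulKf ?mulfV ?gt_eqF.
have VV : V^T *m V = 1%:M.
  rewrite /V trmxK; apply/matrixP => i j.
  have -> : (rowsub e P *m (rowsub e P)^T) i j = (P *m P^T) (e i) (e j).
    by rewrite !mxE; apply: eq_bigr => k _; rewrite !mxE.
  by rewrite P1 !mxE (inj_eq e_inj).
have XUV : X = U *m diag_mx s *m V^T.
  rewrite /U -(mulmxA _ (diag_mx t)) ts mulmx1 /V trmxK [LHS]WP; apply/matrixP => i k.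
  rewrite !mxE reindexI => [|j /W0 ->]; last by rewrite mul0r.
  by apply: eq_bigr => l _; rewrite !mxE.
clearbody U V.
have rank1 : \rank (diag_mx s) = #|I|.
  by rewrite mxrank_unit//; case/mulmx1_unit: ts.
have rX : #|I| = \rank X.
  apply/eqP; rewrite eqn_leq {2}XUV (leq_trans (mxrankM_maxr _ _)) ?rank_leq_row// andbT.
  rewrite -{1}rank1; have -> : diag_mx s = U^T *m X *m V.
    by rewrite XUV !mulmxA UU mul1mx -mulmxA VV mulmx1.
  by rewrite (leq_trans (mxrankM_maxl _ _))// mxrankM_maxr.
have nX : nuclear_norm X = \tr (diag_mx s).
  rewrite /nuclear_norm (perm_big _ svX) big_map big_enum /= reindexI => [|j ->].
    by apply: eq_bigr => k _; rewrite !mxE eqxx mulr1n.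
  exact: sqrtr0.
have spX c : 0 <= c -> spectral_norm X <= c <-> forall i, diag_mx s i i <= c.
  move=> c0; rewrite /spectral_norm (perm_big _ svX) big_map big_enum /=.
  split=> [/bigmax_leP[_ sc] k|sc]; first by rewrite !mxE eqxx mulr1n sc.
  apply/bigmax_leP; split=> // j _; have [->|dj] := eqVneq (d 0 j) 0.
    by rewrite sqrtr0.
  have jI : j \in I by [].
  by have := sc (enum_rank_in jI j); rewrite !mxE eqxx mulr1n /e enum_rankK_in.
have s_pos i : 0 < diag_mx s i i by rewrite !mxE eqxx mulr1n.
have s_diag := diag_mx_is_diag s.
(* The number of nonzero d_j has been shown to be the rank; the factors must be
   generalized before their dimension can be replaced. *)
move: (diag_mx s) U V UU VV XUV nX spX s_pos s_diag {ts rank1}; clear -rX.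
move: (#|I|) rX => r ->{r} Sigma U V UU VV XUV nX spX s_pos s_diag.
by exists U, Sigma, V.
Qed.

End SVD.

(** * Norms *)

Section Norms.
Variable R : rcfType.

(** The inequality |X| <= c for the operator norm, stated with the bilinear form
    and the arithmetic mean of the squared lengths in place of their geometric
    mean.  Rescaling y against x shows that this is equivalent for c >= 0; the
    condition is linear in (X, c) and involves no square root. *)
Definition opnorm_le (m n : nat) (X : 'M[R]_(m, n)) (c : R) : Prop :=
  forall (y : 'cV[R]_m) (x : 'cV[R]_n),
    2 * frob y (X *m x) <= c * (frob y y + frob x x).

Definition contraction (m n : nat) (A : 'M[R]_(m, n)) : Prop :=
  forall x : 'cV[R]_n, frob (A *m x) (A *m x) <= frob x x.

Lemma double_frob_le (m n : nat) (A B : 'M[R]_(m, n)) :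
  2 * frob A B <= frob A A + frob B B.
Proof.
by have := frob_ge0 (A - B); rewrite !frobDl !frobDr -scaleN1r !frobZl !frobZr (frobC B A); lra.
Qed.

(** U U^T is the orthogonal projection onto the column space of U. *)
Lemma frob_pythagoras (m r : nat) (U : 'M[R]_(m, r)) (y : 'cV[R]_m) :
  U^T *m U = 1%:M ->
  frob y y = frob (U^T *m y) (U^T *m y)
           + frob ((1%:M - U *m U^T) *m y) ((1%:M - U *m U^T) *m y).
Proof.
move=> U1; rewrite mulmxBl mul1mx -mulmxA.
have yUy : frob y (U *m (U^T *m y)) = frob (U^T *m y) (U^T *m y) by rewrite frob_mulr.
have UyUy : frob (U *m (U^T *m y)) (U *m (U^T *m y)) = frob (U^T *m y) (U^T *m y).
  by rewrite frob_mull (mulmxA U^T U) U1 mul1mx.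
rewrite -(scaleN1r (U *m _)) !frobDl !frobDr !frobZl !frobZr (frobC _ y) yUy UyUy.
by ring.
Qed.

Lemma contraction_tr_isometry (m r : nat) (U : 'M[R]_(m, r)) :
  U^T *m U = 1%:M -> contraction U^T.
Proof. by move=> U1 y; rewrite (frob_pythagoras y U1) lerDl frob_ge0. Qed.

Lemma contraction_proj (m r : nat) (U : 'M[R]_(m, r)) :
  U^T *m U = 1%:M -> contraction (U *m U^T).
Proof.
move=> U1 y; rewrite -mulmxA frob_mull (mulmxA U^T U) U1 mul1mx.
exact: contraction_tr_isometry.
Qed.

Lemma contraction_compl_proj (m r : nat) (U : 'M[R]_(m, r)) :
  U^T *m U = 1%:M -> contraction (1%:M - U *m U^T).
Proof. by move=> U1 y; rewrite [leRHS](frob_pythagoras y U1) lerDr frob_ge0. Qed.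

Lemma contraction1 (n : nat) : contraction (1%:M : 'M[R]_n).
Proof. by move=> x; rewrite mul1mx. Qed.

Lemma frob_delta (k : nat) (l : 'I_k) : frob (delta_mx l 0 : 'cV[R]_k) (delta_mx l 0) = 1.
Proof. by rewrite /frob trmx_delta mul_delta_mx trace_mx11 mxE !eqxx. Qed.

Section OpnormLe.
Variables m n : nat.
Implicit Types X Y : 'M[R]_(m, n).

Lemma opnorm_leW X (b c : R) : b <= c -> opnorm_le X b -> opnorm_le X c.
Proof.
move=> bc Xb y x; apply: le_trans (Xb y x) _.
by rewrite ler_wpM2r// addr_ge0 ?frob_ge0.
Qed.

Lemma opnorm_leD X Y (b c : R) :
  opnorm_le X b -> opnorm_le Y c -> opnorm_le (X + Y) (b + c).
Proof.
by move=> Xb Yc y x; rewrite mulmxDl frobDr mulrDr [leRHS]mulrDl lerD.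
Qed.

Lemma opnorm_leZ X (a c : R) : 0 <= a -> opnorm_le X c -> opnorm_le (a *: X) (a * c).
Proof.
by move=> a0 Xc y x; rewrite -scalemxAl frobZr mulrCA -mulrA ler_wpM2l.
Qed.

Lemma opnorm_le_norm1 X : opnorm_le X (norm1 X).
Proof.
move=> y x; rewrite frobE mulr_sumr /norm1 mulr_suml; apply: ler_sum => i _.
rewrite big_ord1 mxE !mulr_sumr mulr_suml; apply: ler_sum => j _.
have coord_le (k : nat) (v : 'cV[R]_k) l : v l 0 ^+ 2 <= frob v v.
  rewrite frobE (bigD1 l)//= big_ord1 expr2 lerDl sumr_ge0// => ? _.
  by rewrite big_ord1 -expr2 sqr_ge0.
apply: le_trans (_ : `|X i j| * (y i 0 ^+ 2 + x j 0 ^+ 2) <= _); last first.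
  by rewrite ler_wpM2l// lerD.
have [X0|X0] := leP 0 (X i j).
  rewrite ger0_norm//; have := mulr_ge0 X0 (sqr_ge0 (y i 0 - x j 0)).
  by lra.
have X0' : 0 <= - X i j by rewrite oppr_ge0 ltW.
rewrite ltr0_norm//; have := mulr_ge0 X0' (sqr_ge0 (y i 0 + x j 0)); lra.
Qed.

Lemma opnorm_le_entry X (c : R) i j : opnorm_le X c -> `|X i j| <= c.
Proof.
move=> Xc.
have entry : frob (delta_mx i 0 : 'cV[R]_m) (X *m (delta_mx j 0 : 'cV[R]_n)) = X i j.
  rewrite /frob trmx_delta -rowE -colE trace_mx11; first by rewrite !mxE.
have := Xc (delta_mx i 0) (delta_mx j 0); rewrite entry !frob_delta.
have := Xc (- delta_mx i 0) (delta_mx j 0).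
rewrite -scaleN1r !frobZl !frobZr entry !frob_delta => ? ?.
by rewrite ler_norml; apply/andP; split; lra.
Qed.

Lemma opnorm_le_contraction (m' n' : nat) (A : 'M[R]_(m, m')) (B : 'M[R]_(n, n')) X c :
  contraction A -> contraction B -> 0 <= c ->
  opnorm_le X c -> opnorm_le (A^T *m X *m B) c.
Proof.
move=> cA cB c0 Xc y x; rewrite -!mulmxA frob_mulr trmxK.
apply: le_trans (Xc _ _) _; rewrite ler_wpM2l// lerD//.
Qed.

(** The diagonal entries are the values of the bilinear form of X at pairs of
    unit vectors, namely the columns of U and V. *)
Lemma opnorm_le_diag (r : nat) (U : 'M[R]_(m, r)) (V : 'M[R]_(n, r)) X c i :
  U^T *m U = 1%:M -> V^T *m V = 1%:M -> opnorm_le X c -> (U^T *m X *m V) i i <= c.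
Proof.
move=> U1 V1 Xc.
have -> : (U^T *m X *m V) i i
    = frob (U *m delta_mx i 0 : 'cV[R]_m) (X *m (V *m delta_mx i 0 : 'cV[R]_n)).
  by rewrite frob_mull !mulmxA /frob trmx_delta -rowE -colE trace_mx11 !mxE.
have := Xc (U *m delta_mx i 0) (V *m delta_mx i 0).
by rewrite !(frob_mull _ (delta_mx i 0)) !(mulmxA _^T) U1 V1 !mul1mx !frob_delta; lra.
Qed.

(** Both sides are read off a singular value decomposition [U Sigma V^T]: the
    bilinear form at (y, x) is the sum of the [s_i a_i b_i] with [a = U^T y]
    and [b = V^T x], and the i-th singular vectors attain [s_i]. *)
Lemma spectral_norm_leP X c : 0 <= c -> spectral_norm X <= c <-> opnorm_le X c.
Proof.
move=> c0; have [U [S [V [[U1 V1 [Sd Sp] XE] _ sX]]]] := svd_exists X.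
rewrite sX// {sX}; split=> [Sc y x|Xc i].
  rewrite XE -!mulmxA frob_mulr.
  apply: le_trans (_ : c * (frob (U^T *m y) (U^T *m y) + frob (V^T *m x) (V^T *m x)) <= _).
    move: (U^T *m y) (V^T *m x) => a b; rewrite !frobE -big_split /= !mulr_sumr.
    apply: ler_sum => i _; rewrite !big_ord1 mxE (bigD1 i)//= big1 ?addr0 => [|k ki]; last first.
      by rewrite (is_diag_mxP Sd) ?mul0r// eq_sym.
    apply: le_trans (_ : S i i * (a i 0 * a i 0 + b i 0 * b i 0) <= _).
      have := mulr_ge0 (ltW (Sp i)) (sqr_ge0 (a i 0 - b i 0)); lra.
    by rewrite ler_wpM2r// addr_ge0// -expr2 sqr_ge0.
  by rewrite ler_wpM2l// lerD//; exact: contraction_tr_isometry.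
have -> : S = U^T *m X *m V; last exact: opnorm_le_diag.
have := congr1 (fun Z => U^T *m Z *m V) XE.
by rewrite !mulmxA U1 mul1mx -(mulmxA S) V1 mulmx1.
Qed.

Lemma spectral_norm_ge0 X : 0 <= spectral_norm X.
Proof. by rewrite /spectral_norm; elim/big_rec: _ => // s t _ t0; rewrite le_max t0 orbT. Qed.

Lemma opnorm_le_spectral X : opnorm_le X (spectral_norm X).
Proof. by apply/spectral_norm_leP => //; exact: spectral_norm_ge0. Qed.

(** Duality of the nuclear and spectral norms: with X = U Sigma V^T, the
    pairing is the sum of the [s_i (u_i^T Q v_i)]. *)
Lemma frob_le_nuclear_norm (Q X : 'M[R]_(m, n)) :
  opnorm_le Q 1 -> frob Q X <= nuclear_norm X.
Proof.
move=> Q1; have [U [S [V [[U1 V1 [Sd Sp] XE] -> _]]]] := svd_exists X.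
rewrite {1}XE -mulmxA frob_mulr frobC frob_mulrr trmxK frobE.
apply: ler_sum => i _; rewrite (bigD1 i)//= big1 ?addr0 => [|k ki]; last first.
  by rewrite (is_diag_mxP Sd) ?mul0r// eq_sym.
rewrite ler_piMr ?(ltW (Sp i))//.
exact: opnorm_le_diag.
Qed.

Lemma norm_max_entry X i j : `|X i j| <= norm_max X.
Proof. by rewrite /norm_max mx_normrE (le_bigmax _ (fun ij => `|X ij.1 ij.2|) (i, j)). Qed.

Lemma norm_max_leP X c : 0 <= c -> reflect (forall i j, `|X i j| <= c) (norm_max X <= c).
Proof.
rewrite /norm_max mx_normrE => c0; apply: (iffP (bigmax_leP _ _ _ _)) => [[_ Xc] i j|Xc].
  exact: Xc (i, j) isT.
by split.
Qed.

Lemma norm_max_ge0 X : 0 <= norm_max X.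
Proof. exact: (normr_ge0 X). Qed.

Lemma norm_maxD X Y : norm_max (X + Y) <= norm_max X + norm_max Y.
Proof. exact: ler_mx_norm_add. Qed.

Lemma norm_maxZ a X : norm_max (a *: X) = `|a| * norm_max X.
Proof. exact: mx_normZ. Qed.

End OpnormLe.

Lemma norm1_mul_le (m p n : nat) (G : 'M[R]_(m, p)) (A : 'M[R]_(p, n)) :
  norm1 (G *m A) <= norm1 G * n%:R * norm_max A.
Proof.
rewrite /norm1 !mulr_suml; apply: ler_sum => i _.
rewrite -mulrA (mulrC n%:R) mulr_natr -[X in _ * (_ *+ X)](card_ord n) -sumr_const mulr_sumr.
apply: ler_sum => j _; rewrite mxE mulr_suml.
apply: le_trans (ler_norm_sum _ _ _) _; apply: ler_sum => k _.
by rewrite normrM ler_wpM2l// norm_max_entry.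
Qed.

End Norms.

(** * The incoherence parameters *)

Section Incoherence.
Variable R : realType.

Section Mu.
Variables (m p n : nat) (G : 'M[R]_(m, p)) (S : 'M[R]_(p, n)).

(** A supremum of an unbounded set would be 0 by convention, so boundedness is
    what makes [mu] and [xi] dominate the norms they range over. *)
Lemma mu_has_ubound : has_ubound
  [set spectral_norm (G *m A) | A in [set A | Omega S A /\ norm_max A <= 1]]%classic.
Proof.
exists (norm1 G * n%:R) => _ [A [_ A1] <-].
have G0 : 0 <= norm1 G * n%:R by rewrite mulr_ge0// sumr_ge0// => i _; rewrite sumr_ge0.
apply/(spectral_norm_leP _ G0); apply: opnorm_leW (opnorm_le_norm1 _).
by apply: le_trans (norm1_mul_le _ _) _; rewrite ler_piMr.
Qed.

Lemma mu_ge0 : 0 <= mu G S.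
Proof.
apply: (le_trans (spectral_norm_ge0 (G *m 0))); apply: (ub_le_sup mu_has_ubound).
exists 0 => //; split; first by move=> i j; rewrite mxE eqxx.
by apply/norm_max_leP => // i j; rewrite mxE normr0.
Qed.

Lemma opnorm_le_mu A : Omega S A -> opnorm_le (G *m A) (mu G S * norm_max A).
Proof.
move=> AS; have [A0|A0] := eqVneq (norm_max A) 0.
  rewrite A0 mulr0; have -> : A = 0 by exact: mx_norm_eq0.
  by rewrite mulmx0 => y x; rewrite mul0mx frob0r mul0r mulr0.
have Ap : 0 < norm_max A by rewrite lt_neqAle eq_sym A0 norm_max_ge0.
pose A' := (norm_max A)^-1 *: A.
have AE : A = norm_max A *: A' by rewrite scalerA mulfV// scale1r.
rewrite {1}AE -scalemxAr mulrC; apply: opnorm_leZ; first exact: ltW.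
apply: opnorm_leW (opnorm_le_spectral _); apply: (ub_le_sup mu_has_ubound).
exists A' => //; split; first by move=> i j; rewrite mxE mulf_eq0 negb_or => /andP[_]; exact: AS.
by rewrite norm_maxZ gtr0_norm ?invr_gt0// mulVf.
Qed.

End Mu.

Section Xi.
Variables (m p n : nat) (G : 'M[R]_(m, p)) (L : 'M[R]_(m, n)).

Lemma tangent_spaceZ a B : tangent_space L B -> tangent_space L (a *: B).
Proof.
move=> [U [S [V [svdL [X [Y ->]]]]]]; exists U, S, V; split=> //.
by exists (a *: X), (a *: Y); rewrite scalerDr linearZ /= -scalemxAr -scalemxAl.
Qed.

Lemma xi_has_ubound : has_ubound
  [set norm_max (G^T *m B) | B in [set B | tangent_space L B /\ spectral_norm B <= 1]]%classic.
Proof.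
exists (norm1 G^T * n%:R) => _ [B [_ B1] <-].
have G0 : 0 <= norm1 G^T * n%:R by rewrite mulr_ge0// sumr_ge0// => i _; rewrite sumr_ge0.
apply/norm_max_leP => // i j; apply: (opnorm_le_entry i j).
apply: opnorm_leW (opnorm_le_norm1 _).
apply: le_trans (norm1_mul_le _ _) _; rewrite ler_piMr//.
apply/norm_max_leP => // k l; apply: (opnorm_le_entry k l).
exact/spectral_norm_leP.
Qed.

Lemma xi_ge0 : 0 <= xi G L.
Proof.
apply: (le_trans (norm_max_ge0 (G^T *m 0))); apply: (ub_le_sup xi_has_ubound).
exists 0 => //; split.
  have [U [S [V [svdL _ _]]]] := svd_exists L; exists U, S, V; split=> //.
  by exists 0, 0; rewrite trmx0 mulmx0 mul0mx addr0.
by apply/spectral_norm_leP => // y x; rewrite mul0mx frob0r mulr0 mul1r addr_ge0 ?frob_ge0.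
Qed.

Lemma norm_max_xi_le B c : tangent_space L B -> 0 <= c -> opnorm_le B c ->
  norm_max (G^T *m B) <= xi G L * c.
Proof.
move=> BT; rewrite le_eqVlt => /predU1P[<-|c0] Bc.
  have -> : B = 0.
    by apply/matrixP => i j; apply/eqP; rewrite mxE -normr_le0 (opnorm_le_entry i j Bc).
  by rewrite mulmx0 mulr0; apply/norm_max_leP => // i j; rewrite mxE normr0.
have BE : B = c *: (c^-1 *: B) by rewrite scalerA mulfV ?scale1r ?gt_eqF.
rewrite {1}BE -scalemxAr norm_maxZ gtr0_norm// mulrC ler_pM2r//.
apply: (ub_le_sup xi_has_ubound); exists (c^-1 *: B) => //; split.
  exact: tangent_spaceZ.
apply/spectral_norm_leP => //; rewrite -[1](mulVf (lt0r_neq0 c0)).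
by apply: opnorm_leZ => //; rewrite invr_ge0 ltW.
Qed.

End Xi.
End Incoherence.

(** * The projection onto the normal space *)

Section NormalProjection.
Variable R : rcfType.

(** When U and V come from a reduced singular value decomposition of L, this is
    the orthogonal projection onto the orthogonal complement of the tangent
    space at L; the tangent space itself is reached as [M - normal_proj U V M]. *)
Definition normal_proj (m n r : nat) (U : 'M[R]_(m, r)) (V : 'M[R]_(n, r))
    (M : 'M[R]_(m, n)) : 'M[R]_(m, n) :=
  (1%:M - U *m U^T) *m M *m (1%:M - V *m V^T).

Lemma compl_proj_sym (m r : nat) (U : 'M[R]_(m, r)) :
  (1%:M - U *m U^T)^T = 1%:M - U *m U^T.
Proof. by rewrite linearB /= trmx_mul trmxK trmx1. Qed.

Lemma compl_projK (m r : nat) (U : 'M[R]_(m, r)) : U^T *m U = 1%:M ->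
  (1%:M - U *m U^T) *m U = 0.
Proof. by move=> U1; rewrite mulmxBl mul1mx -mulmxA U1 mulmx1 subrr. Qed.

Lemma compl_proj_idem (m r : nat) (U : 'M[R]_(m, r)) : U^T *m U = 1%:M ->
  (1%:M - U *m U^T) *m (1%:M - U *m U^T) = 1%:M - U *m U^T.
Proof. by move=> U1; rewrite [LHS]mulmxBr mulmx1 mulmxA compl_projK// mul0mx subr0. Qed.

Variables (m n r : nat) (U : 'M[R]_(m, r)) (V : 'M[R]_(n, r)).
Hypotheses (U1 : U^T *m U = 1%:M) (V1 : V^T *m V = 1%:M).
Implicit Types M N : 'M[R]_(m, n).

Lemma normal_proj_linear : linear (normal_proj U V).
Proof.
move=> a M N; rewrite /normal_proj; move: (1%:M - _) (1%:M - _) => P Q.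
by rewrite mulmxDr mulmxDl -scalemxAr -scalemxAl.
Qed.

Lemma normal_projD M N : normal_proj U V (M + N) = normal_proj U V M + normal_proj U V N.
Proof. by rewrite /normal_proj; move: (1%:M - _) (1%:M - _) => P Q; rewrite mulmxDr mulmxDl. Qed.

Lemma normal_projZ a M : normal_proj U V (a *: M) = a *: normal_proj U V M.
Proof. by rewrite /normal_proj -scalemxAr -scalemxAl. Qed.

Lemma normal_proj0 : normal_proj U V 0 = 0.
Proof. by rewrite /normal_proj mulmx0 mul0mx. Qed.

Lemma frob_normal_projC M N : frob (normal_proj U V M) N = frob M (normal_proj U V N).
Proof.
by rewrite /normal_proj frob_mulrr frob_mull !compl_proj_sym mulmxA.
Qed.

Lemma frob_normal_proj M :
  frob (normal_proj U V M) (normal_proj U V M) = frob (normal_proj U V M) M.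
Proof.
have NN : normal_proj U V (normal_proj U V M) = normal_proj U V M.
  by rewrite /normal_proj !mulmxA (compl_proj_idem U1) -!mulmxA (compl_proj_idem V1).
by rewrite frob_normal_projC NN frobC.
Qed.

Lemma normal_proj_svd (S : 'M[R]_r) : normal_proj U V (U *m S *m V^T) = 0.
Proof. by rewrite /normal_proj !mulmxA compl_projK// !mul0mx. Qed.

(** With P = U U^T and P' = V V^T, the tangential part of M is
    P M + (1 - P) M P', a sum of two compressions of M. *)
Lemma opnorm_le_sub_normal_proj M c : 0 <= c -> opnorm_le M c ->
  opnorm_le (M - normal_proj U V M) (c + c).
Proof.
move=> c0 Mc.
have -> : M - normal_proj U V M =
    (U *m U^T)^T *m M *m 1%:M + (1%:M - U *m U^T)^T *m M *m (V *m V^T).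
  rewrite compl_proj_sym trmx_mul trmxK mulmx1 /normal_proj mulmxBr mulmx1 opprB.
  rewrite addrCA addrC; congr (_ + _).
  by rewrite mulmxBl mul1mx opprB addrCA subrr addr0.
have cP := opnorm_le_contraction.
apply: opnorm_leD; apply: cP => //.
- exact: contraction_proj.
- exact: contraction1.
- exact: contraction_compl_proj.
- exact: contraction_proj.
Qed.

(** U V^T and the normal component act between orthogonal pairs of subspaces,
    so the operator norm of their sum is the larger of the two. *)
Lemma opnorm_le_certificate M : opnorm_le M 1 ->
  opnorm_le (U *m V^T + normal_proj U V M) 1.
Proof.
move=> M1 y x; rewrite mulmxDl frobDr mulrDr.
rewrite (frob_pythagoras y U1) (frob_pythagoras x V1).
have h1 : 2 * frob y (U *m V^T *m x) <=
    frob (U^T *m y) (U^T *m y) + frob (V^T *m x) (V^T *m x).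
  by rewrite -mulmxA frob_mulr; exact: double_frob_le.
have h2 := M1 ((1%:M - U *m U^T) *m y) ((1%:M - V *m V^T) *m x).
have e : frob y (normal_proj U V M *m x) =
    frob ((1%:M - U *m U^T) *m y) (M *m ((1%:M - V *m V^T) *m x)).
  by rewrite frob_mull compl_proj_sym /normal_proj !mulmxA.
by rewrite e; lra.
Qed.

End NormalProjection.

Section TangentSpace.
Variable R : rcfType.
Variables (m n : nat) (L : 'M[R]_(m, n)).
Variables (U : 'M[R]_(m, \rank L)) (Sigma : 'M[R]_(\rank L)) (V : 'M[R]_(n, \rank L)).
Hypothesis svdL : reduced_svd L U Sigma V.

Lemma tangent_sub_normal_proj M : tangent_space L (M - normal_proj U V M).
Proof.
exists U, Sigma, V; split=> //; exists (M^T *m U), ((1%:M - U *m U^T) *m M *m V).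
rewrite trmx_mul trmxK /normal_proj mulmxBr mulmx1 opprB.
rewrite addrCA addrC mulmxA -!mulmxA; congr (_ + _).
by rewrite mulmxBl mul1mx opprB addrCA subrr addr0 !mulmxA.
Qed.

Lemma tangent_polar : tangent_space L (U *m V^T).
Proof.
by exists U, Sigma, V; split=> //; exists V, 0; rewrite mul0mx addr0.
Qed.

(** The polar factor U V^T attains the duality bound at L. *)
Lemma frob_polar : frob (U *m V^T) L = \tr Sigma.
Proof.
have [U1 V1 _ LE] := svdL.
rewrite [X in frob _ X]LE frob_mull !mulmxA U1 mul1mx frobC frob_mulrr trmxK V1.
by rewrite frobC /frob trmx1 mul1mx.
Qed.

Lemma normal_proj_self : normal_proj U V L = 0.
Proof. by have [U1 _ _ LE] := svdL; rewrite [X in normal_proj _ _ X]LE normal_proj_svd. Qed.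

End TangentSpace.

(** * Dual certificates *)

Lemma injective_linear_surjective (F : fieldType) (vT : vectType F) (f : vT -> vT) :
  linear f -> (forall u, f u = 0 -> u = 0) -> forall v, exists u, f u = v.
Proof.
move=> lin_f inj_f v.
pose fL : {linear vT -> vT} := HB.pack f (GRing.isLinear.Build _ _ _ _ f lin_f).
have ker0 : lker (linfun fL) == 0%VS.
  by apply/lker0P => u w; rewrite !lfunE /= => e; apply/eqP; rewrite -subr_eq0; apply/eqP/inj_f;
     rewrite -[f]/(fL : vT -> vT) linearB /= e subrr.
exists ((linfun fL)^-1%VF v).
by have := lker0_lfunVK ker0 v; rewrite lfunE.
Qed.

Section Support.
Variables (R : rcfType) (p n : nat) (S : 'M[R]_(p, n)).

Definition restrict (A : 'M[R]_(p, n)) : 'M[R]_(p, n) :=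
  \matrix_(i, j) if S i j == 0 then 0 else A i j.

Lemma restrict_id A : Omega S A -> restrict A = A.
Proof.
move=> AS; apply/matrixP => i j; rewrite mxE; case: eqP => // Sij.
by apply/esym/eqP; apply: contra_eqT Sij => /AS.
Qed.

Lemma OmegaB A B : Omega S A -> Omega S B -> Omega S (A - B).
Proof.
move=> AS BS i j; rewrite !mxE; have [->|/AS //] := eqVneq (A i j) 0.
by rewrite sub0r oppr_eq0; exact: BS.
Qed.

Lemma Omega_eq0 A i j : Omega S A -> S i j = 0 -> A i j = 0.
Proof. by move=> AS Sij; apply/eqP; apply: contra_eqT Sij => /AS. Qed.

End Support.

Section Certificate.
Variable R : rcfType.
Variables (m p n : nat) (G : 'M[R]_(m, p)) (S0 : 'M[R]_(p, n)) (L : 'M[R]_(m, n)).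
Variables (U : 'M[R]_(m, \rank L)) (Sigma : 'M[R]_(\rank L)) (V : 'M[R]_(n, \rank L)).
Hypothesis svdL : reduced_svd L U Sigma V.
Hypothesis nucL : nuclear_norm L = \tr Sigma.
Hypothesis transversal :
  forall A, Omega S0 A -> normal_proj U V (G *m A) = 0 -> A = 0.

(** The compression to Omega of the positive semidefinite operator
    [A |-> G^T N (G A)], with N the normal projection, is injective by
    transversality, hence onto. *)
Lemma certificate_exists (B : 'M[R]_(p, n)) :
  exists A, Omega S0 A /\
    forall i j, S0 i j != 0 -> (G^T *m normal_proj U V (G *m A)) i j = B i j.
Proof.
have [U1 V1 _ _] := svdL.
pose T A := G^T *m normal_proj U V (G *m A).
have T_lin : linear T.
  by move=> a A A'; rewrite /T mulmxDr -scalemxAr normal_proj_linear mulmxDr -scalemxAr.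
(* Off the support this is the identity, which makes it an endomorphism of
   the space of all matrices. *)
pose Phi (A : 'M[R]_(p, n)) := \matrix_(i, j) if S0 i j == 0 then A i j else T (restrict S0 A) i j.
have Phi_lin : linear Phi.
  move=> a A A'; have -> : Phi (a *: A + A') = \matrix_(i, j)
      if S0 i j == 0 then (a *: A + A') i j
      else (a *: T (restrict S0 A) + T (restrict S0 A')) i j.
    rewrite -T_lin; have <- // : restrict S0 (a *: A + A') = a *: restrict S0 A + restrict S0 A'.
    by apply/matrixP => k l; rewrite !mxE; case: ifP; rewrite ?mulr0 ?addr0.
  by apply/matrixP => i j; rewrite !mxE; case: ifP; rewrite // !mxE.
have Phi_supp A : (forall i j, S0 i j = 0 -> Phi A i j = 0) -> Omega S0 A.
  move=> h i j; apply: contraNneq => Sij; have := h i j Sij.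
  by rewrite mxE Sij eqxx => ->.
have [A AB] : exists A, Phi A = restrict S0 B.
  apply: injective_linear_surjective => // A A0.
  have AS : Omega S0 A by apply: Phi_supp => i j _; rewrite A0 mxE.
  apply: transversal => //; apply/frob_eq0; rewrite frob_normal_proj// frob_mulr frobE.
  rewrite big1 // => i _; rewrite big1 // => j _.
  have [Sij|Sij] := eqVneq (S0 i j) 0; first by rewrite (Omega_eq0 AS Sij) mulr0.
  have /matrixP/(_ i j) := A0; rewrite mxE [RHS]mxE (negPf Sij) restrict_id// => TA.
  by rewrite -/(T A) TA mul0r.
have AS : Omega S0 A by apply: Phi_supp => i j Sij; rewrite AB mxE Sij eqxx.
exists A; split=> // i j Sij.
by have /matrixP/(_ i j) := AB; rewrite mxE [RHS]mxE (negPf Sij) restrict_id.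
Qed.

Variables (gamma theta : R) (Z : 'M[R]_(m, n)).
Hypotheses (gamma_gt0 : 0 < gamma) (theta_lt1 : theta < 1) (Ztheta : opnorm_le Z theta).
Let Q := U *m V^T + normal_proj U V Z.
Hypothesis Q_support :
  forall i j, S0 i j != 0 -> (G^T *m Q) i j = gamma * Num.sg (S0 i j).
Hypothesis Q_off :
  forall i j, S0 i j = 0 -> `|(G^T *m Q) i j| < gamma.

Lemma certificate_entry_le (S : 'M[R]_(p, n)) i j : (G^T *m Q) i j * S i j <= gamma * `|S i j|.
Proof.
apply: le_trans (ler_norm _) _; rewrite normrM ler_wpM2r//.
have [Sij|Sij] := eqVneq (S0 i j) 0; first exact/ltW/Q_off.
by rewrite Q_support// normrM gtr0_norm// normr_sg Sij mulr1.
Qed.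

Lemma certificate_pairing_le (S : 'M[R]_(p, n)) : frob (G^T *m Q) S <= gamma * norm1 S.
Proof.
rewrite frobE /norm1 mulr_sumr; apply: ler_sum => i _; rewrite mulr_sumr.
by apply: ler_sum => j _; exact: certificate_entry_le.
Qed.

(** Each entry contributes a nonnegative gap, so equality of the sums makes every
    gap vanish; off the support of S0 the gap is strict unless the entry of S
    is 0. *)
Lemma certificate_pairing_eq (S : 'M[R]_(p, n)) :
  gamma * norm1 S <= frob (G^T *m Q) S -> Omega S0 S.
Proof.
move=> ge i j; apply: contraNneq => Sij.
pose gap i j := gamma * `|S i j| - (G^T *m Q) i j * S i j.
have gap_ge0 k l : 0 <= gap k l by rewrite subr_ge0 certificate_entry_le.
have : \sum_k \sum_l gap k l <= 0.
  apply: le_trans (_ : gamma * norm1 S - frob (G^T *m Q) S <= 0); last by rewrite subr_le0.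
  rewrite frobE /norm1 mulr_sumr -sumrB; apply: ler_sum => k _.
  by rewrite mulr_sumr -sumrB.
rewrite (bigD1 i)//= (bigD1 j)//= => sum_le0.
have gap_le0 : gap i j <= 0.
  apply: le_trans sum_le0; rewrite -addrA lerDl addr_ge0 ?sumr_ge0// => k _.
  exact: sumr_ge0.
rewrite -normr_le0 leNgt; apply/negP => Spos; move: gap_le0; apply/negP; rewrite -ltNge.
rewrite subr_gt0; apply: le_lt_trans (ler_norm _) _; rewrite normrM ltr_pM2r//.
exact: Q_off.
Qed.

Lemma certificate_pairing_self : frob (G^T *m Q) S0 = gamma * norm1 S0.
Proof.
rewrite frobE /norm1 mulr_sumr; apply: eq_bigr => i _; rewrite mulr_sumr.
apply: eq_bigr => j _; have [->|Sij] := eqVneq (S0 i j) 0; first by rewrite normr0 !mulr0.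
by rewrite Q_support// -mulrA -normrEsg.
Qed.

(** Weak duality against the certificate Q, with strictness in both terms. *)
Lemma certificate_recovery (S : 'M[R]_(p, n)) (Y : 'M[R]_(m, n)) :
  optimizer gamma G (L + G *m S0) S Y -> S = S0.
Proof.
have [U1 V1 _ _] := svdL; have NL := normal_proj_self svdL.
move=> [feas opt].
have QL : frob Q L = nuclear_norm L.
  by rewrite /Q frobDl frob_normal_projC NL frob0r addr0 nucL (frob_polar svdL).
have Q1 : opnorm_le Q 1 by apply: opnorm_le_certificate => //; apply: opnorm_leW Ztheta; exact: ltW.
have QY := frob_le_nuclear_norm Y Q1.
have QS := certificate_pairing_le S.
have pairing : frob Q Y + frob (G^T *m Q) S = nuclear_norm L + gamma * norm1 S0.
  by rewrite -QL -certificate_pairing_self -!frob_mulr -!frobDr feas.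
have opt0 := opt S0 L erefl.
have SO : Omega S0 S by apply: certificate_pairing_eq; move: QY pairing opt0; lra.
(* Since theta < 1, Z can be moved by a small multiple e of Y without leaving the
   unit ball.  The pairing with Y then grows by e |N Y|^2, yet it is already
   equal to the nuclear norm of Y, so N Y = 0. *)
have NY : normal_proj U V Y = 0.
  have Y0 : 0 <= norm1 Y by rewrite sumr_ge0// => i _; rewrite sumr_ge0.
  pose e := (1 - theta) / (1 + norm1 Y).
  have e0 : 0 < e by rewrite divr_gt0 ?subr_gt0 ?ltr_wpDr.
  have eY : theta + e * norm1 Y <= 1.
    rewrite -lerBrDl /e -mulrA ger_pMr ?subr_gt0// mulrC ler_pdivrMr ?ltr_wpDr//.
    by rewrite mul1r lerDr.
  have Q'1 : opnorm_le (U *m V^T + normal_proj U V (Z + e *: Y)) 1.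
    apply: opnorm_le_certificate => //; apply: opnorm_leW eY _.
    by apply: opnorm_leD => //; apply: opnorm_leZ; [exact: ltW|exact: opnorm_le_norm1].
  have := frob_le_nuclear_norm Y Q'1.
  rewrite normal_projD normal_projZ addrA -/Q frobDl frobZl -(frob_normal_proj U1 V1) => Q'Y.
  apply/frob_eq0/eqP; rewrite eq_le frob_ge0 andbT -(pmulr_rle0 _ e0).
  by move: QS pairing opt0 Q'Y; lra.
apply/eqP; rewrite -subr_eq0; apply/eqP/transversal; first exact: OmegaB.
have -> : G *m (S - S0) = L + (- 1) *: Y.
  by rewrite mulmxBr scaleN1r; apply/eqP; rewrite subr_eq addrAC -feas addrAC subrr add0r.
by rewrite normal_projD normal_projZ NL NY scaler0 addr0.
Qed.

End Certificate.

(** * Recovery from incoherence *)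

Section IncoherentPair.
Variable R : realType.
Variables (m p n : nat) (G : 'M[R]_(m, p)) (S0 : 'M[R]_(p, n)) (L : 'M[R]_(m, n)).
Variables (U : 'M[R]_(m, \rank L)) (Sigma : 'M[R]_(\rank L)) (V : 'M[R]_(n, \rank L)).
Hypothesis svdL : reduced_svd L U Sigma V.
Hypothesis nucL : nuclear_norm L = \tr Sigma.
Variables (K : 'M[R]_p) (delta : R).
Hypothesis GG : G^T *m G = 1%:M - K.
Hypothesis delta_ge0 : 0 <= delta.
Hypothesis K_small :
  forall A : 'M[R]_(p, n), Omega S0 A -> norm_max (K *m A) <= delta * norm_max A.
Hypothesis incoherent : mu G S0 * xi G L < (1 - 3 * delta) / 6.

Let k := mu G S0 * xi G L.

Lemma mu_xi_ge0 : 0 <= k.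
Proof. by rewrite mulr_ge0 ?mu_ge0 ?xi_ge0. Qed.

(** A = G^T (G A) + K A, and both terms are small when G A is tangent. *)
Lemma incoherent_transversal A :
  Omega S0 A -> normal_proj U V (G *m A) = 0 -> A = 0.
Proof.
move=> AS NA; apply: mx_norm_eq0; rewrite -/(norm_max A).
have GA : norm_max (G^T *m (G *m A)) <= xi G L * (mu G S0 * norm_max A).
  apply: norm_max_xi_le; last exact: opnorm_le_mu.
    by rewrite -[G *m A]subr0 -NA; exact: (tangent_sub_normal_proj svdL).
  by rewrite mulr_ge0 ?mu_ge0 ?norm_max_ge0.
have AE : A = G^T *m (G *m A) + K *m A by rewrite mulmxA GG mulmxBl mul1mx subrK.
have le_a : norm_max A <= k * norm_max A + delta * norm_max A.
  rewrite {1}AE; apply: le_trans (norm_maxD _ _) _; apply: lerD; last exact: K_small.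
  by apply: le_trans GA _; rewrite /k mulrA (mulrC (xi _ _)).
apply/eqP; rewrite eq_le norm_max_ge0 andbT.
have kd : 0 < 1 - (k + delta) by have := mu_xi_ge0; move: incoherent delta_ge0; rewrite -/k; lra.
by rewrite -(pmulr_rle0 _ kd); move: le_a; lra.
Qed.

(** With gamma = 3 xi + eta, the second requirement reads
    mu eta < 1 - 6 k - delta. *)
Lemma incoherent_gamma_exists :
  exists gamma, [/\ 0 < gamma, 3 * xi G L < gamma & mu G S0 * gamma < 1 - 3 * k - delta].
Proof.
have x0 : 0 <= xi G L := xi_ge0 _ _; have m0 : 0 <= mu G S0 := mu_ge0 _ _.
have gap : 0 < 1 - 6 * k - delta.
  by move: incoherent delta_ge0; rewrite -/k; lra.
pose eta := (1 - 6 * k - delta) / (mu G S0 + 1).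
have m1 : 0 < mu G S0 + 1 by rewrite ltr_wpDl.
have eta0 : 0 < eta by rewrite divr_gt0.
have eta1 : mu G S0 * eta = 1 - 6 * k - delta - eta.
  by rewrite /eta; field; rewrite gt_eqF.
exists (3 * xi G L + eta); split; [lra|lra|].
by rewrite mulrDr eta1 mulrCA -/k; lra.
Qed.

Lemma opnorm_le_polar : opnorm_le (U *m V^T) 1.
Proof.
have [U1 V1 _ _] := svdL; rewrite -[U *m V^T]addr0 -(normal_proj0 U V).
apply: opnorm_le_certificate => // y x; rewrite mul0mx frob0r mulr0 mul1r.
by rewrite addr_ge0 ?frob_ge0.
Qed.

Variable gamma : R.
Hypotheses (gamma_gt0 : 0 < gamma) (gamma_xi : 3 * xi G L < gamma).
Hypothesis gamma_mu : mu G S0 * gamma < 1 - 3 * k - delta.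

(** Everything is bounded through A = G^T Q - (G^T (U V^T) - K A - G^T (G A - N)),
    where the bracket has entries of size at most xi + (2 k + delta) |A|_max: on
    the support G^T Q is known and the equation bounds A, off the support A
    vanishes and the equation bounds G^T Q. *)
Lemma incoherent_certificate : exists A,
  let Q := U *m V^T + normal_proj U V (G *m A) in
  [/\ Omega S0 A, mu G S0 * norm_max A < 1,
      forall i j, S0 i j != 0 -> (G^T *m Q) i j = gamma * Num.sg (S0 i j)
    & forall i j, S0 i j = 0 -> `|(G^T *m Q) i j| < gamma].
Proof.
have [U1 V1 _ _] := svdL.
pose F := gamma *: map_mx Num.sg S0 - G^T *m (U *m V^T).
have [A [AS AF]] := certificate_exists svdL incoherent_transversal F.
exists A => Q; set a := norm_max A; set N := normal_proj U V (G *m A).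
have a0 : 0 <= a := norm_max_ge0 _.
have x0 : 0 <= xi G L := xi_ge0 _ _; have m0 : 0 <= mu G S0 := mu_ge0 _ _.
have k0 := mu_xi_ge0; have inc : 6 * k + 3 * delta < 1 by move: incoherent; rewrite -/k; lra.
have on_support i j : S0 i j != 0 -> (G^T *m Q) i j = gamma * Num.sg (S0 i j).
  by move=> Sij; rewrite /Q mulmxDr mxE (AF _ _ Sij) !mxE addrCA subrr addr0.
have polar_le : norm_max (G^T *m (U *m V^T)) <= xi G L.
  by rewrite -[leRHS]mulr1; apply: norm_max_xi_le; rewrite ?ler01//;
    [exact: (tangent_polar svdL)|exact: opnorm_le_polar].
have tangent_le : norm_max (G^T *m (G *m A - N)) <= 2 * k * a.
  have -> : 2 * k * a = xi G L * (mu G S0 * a + mu G S0 * a) by rewrite /k; ring.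
  apply: norm_max_xi_le; first exact: (tangent_sub_normal_proj svdL).
    by rewrite addr_ge0 ?mulr_ge0.
  by apply: opnorm_le_sub_normal_proj; rewrite ?mulr_ge0//; exact: opnorm_le_mu.
have K_le := K_small AS.
have GQ : G^T *m Q = A + (G^T *m (U *m V^T) - K *m A - G^T *m (G *m A - N)).
  have AE : A = G^T *m (G *m A) + K *m A by rewrite mulmxA GG mulmxBl mul1mx subrK.
  rewrite [X in X + _]AE /Q (mulmxDr G^T) (mulmxBr G^T).
  move: (G^T *m (U *m V^T)) (G^T *m N) (G^T *m (G *m A)) (K *m A) => P1 P2 P3 P4.
  by apply/matrixP => i j; rewrite !mxE; ring.
have rest_le i j : `|(G^T *m (U *m V^T) - K *m A - G^T *m (G *m A - N)) i j|
    <= xi G L + (2 * k + delta) * a.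
  have := le_trans (norm_max_entry (G^T *m (U *m V^T)) i j) polar_le.
  have := le_trans (norm_max_entry _ i j) K_le.
  have := le_trans (norm_max_entry _ i j) tangent_le.
  set P1 := G^T *m (U *m V^T); set P2 := K *m A; set P3 := G^T *m (G *m A - N).
  have -> : (P1 - P2 - P3) i j = P1 i j - P2 i j - P3 i j by rewrite !mxE.
  move: (P1 i j) (P2 i j) (P3 i j) => u v w hw hv hu.
  apply: le_trans (ler_normB _ _) _; have := ler_normB u v; rewrite -/a in hv *; lra.
have a_le : a <= gamma + (xi G L + (2 * k + delta) * a).
  apply/norm_max_leP => [|i j].
    by rewrite !addr_ge0 ?mulr_ge0 ?addr_ge0 ?mulr_ge0// ltW.
  have [Sij|Sij] := eqVneq (S0 i j) 0.
    by rewrite (Omega_eq0 AS Sij) normr0 !addr_ge0 ?mulr_ge0 ?addr_ge0 ?mulr_ge0// ltW.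
  have := rest_le i j; set rest := (X in `|X i j| <= _) => rij.
  have -> : A i j = (G^T *m Q) i j - rest i j by rewrite GQ [X in X - _]mxE addrK.
  apply: le_trans (ler_normB _ _) _; apply: lerD => //.
  by rewrite (on_support _ _ Sij) normrM normr_sg Sij mulr1 gtr0_norm.
have a_bound : (1 - (2 * k + delta)) * a <= gamma + xi G L by move: a_le; lra.
have c1 : 0 < 1 - (2 * k + delta) by lra.
split=> // [|i j Sij].
  rewrite -(ltr_pM2l c1) mulrCA mulr1.
  apply: le_lt_trans (ler_wpM2l m0 a_bound) _; rewrite mulrDr -/k; have := gamma_mu; lra.
rewrite GQ mxE (Omega_eq0 AS Sij) add0r; apply: le_lt_trans (rest_le i j) _.
have c2 : 0 <= 2 * k + delta by have := delta_ge0; lra.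
rewrite -(ltr_pM2l c1); have := ler_wpM2l c2 a_bound.
have c3 : 0 < 1 / 3 - (2 * k + delta) by have := delta_ge0; lra.
have := mulr_gt0 gamma_gt0 c3; have := gamma_xi; lra.
Qed.

Lemma incoherent_recovery S Y : optimizer gamma G (L + G *m S0) S Y -> S = S0.
Proof.
have [A [AS mA on off]] := incoherent_certificate.
have GA := opnorm_le_mu G AS.
exact: (certificate_recovery svdL nucL incoherent_transversal gamma_gt0 mA GA on off).
Qed.

End IncoherentPair.

(** * The polar factor and the kernel of H *)

Lemma diag_pos_unitmx (R : rcfType) (r : nat) (S : 'M[R]_r) :
  is_diag_mx S -> (forall i, 0 < S i i) -> S \in unitmx.
Proof.
move=> Sd Sp; rewrite unitmxE unitfE det_trig ?is_diag_mx_is_trig//.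
by apply/prodf_neq0 => i _; rewrite gt_eqF.
Qed.

(** V V^T is the projection onto the row space of H, the orthogonal complement
    of its kernel. *)
Lemma ker_proj_svd (R : rcfType) (m p : nat) (H : 'M[R]_(m, p)) U Sigma V :
  reduced_svd H U Sigma V -> ker_proj H = 1%:M - V *m V^T.
Proof.
move=> [U1 V1 [Sd Sp] HE]; rewrite /ker_proj; set K := kermx H^T.
have HT : H^T = V *m Sigma *m U^T.
  have -> : Sigma = Sigma^T.
    apply/matrixP => i j; rewrite [RHS]mxE; have [->//|ij] := eqVneq i j.
    by rewrite !(is_diag_mxP Sd)// eq_sym.
  by rewrite [in LHS]HE !trmx_mul trmxK mulmxA.
have SU : Sigma \in unitmx.
  exact: diag_pos_unitmx.
have KV : K *m V = 0.
  have := mulmx_ker H^T; rewrite -/K HT => /(congr1 (fun Z => Z *m U *m invmx Sigma)).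
  by rewrite -!mulmxA (mulmxA U^T) U1 mul1mx mulmxV// mulmx1 !mul0mx.
pose E := 1%:M - V *m V^T.
have EK : (E <= K)%MS.
  apply/sub_kermxP; rewrite HT mulmxBl mul1mx -!mulmxA (mulmxA V^T) V1 mul1mx subrr //.
have VK : (V *m V^T <= kermx K^T)%MS.
  by apply/sub_kermxP; rewrite -mulmxA -trmx_mul KV trmx0 mulmx0.
have disj : (K :&: kermx K^T)%MS = 0.
  apply/eqP/rowV0P => v; rewrite sub_capmx => /andP[/submxP[w vE] /sub_kermxP vK].
  apply/frob_eq0; rewrite /frob mxtrace_mulC [X in _ *m X^T]vE trmx_mul mulmxA vK mul0mx.
  exact: mxtrace0.
have -> : proj_mx K (kermx K^T) = E.
  rewrite -[LHS]mul1mx -[X in X *m _](subrK (V *m V^T)) mulmxDl.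
  by rewrite proj_mx_id// proj_mx_0// addr0.
by rewrite /E linearB /= trmx_mul trmxK trmx1.
Qed.

Lemma polar_factor (R : rcfType) (m p : nat) (H : 'M[R]_(m, p)) U Sigma V :
  reduced_svd H U Sigma V -> U *m invmx Sigma *m U^T *m H = U *m V^T.
Proof.
move=> [U1 _ [Sd Sp] HE]; rewrite [X in _ *m X]HE !mulmxA -(mulmxA _ U^T) U1 mulmx1.
by rewrite -(mulmxA U) mulVmx ?mulmx1// diag_pos_unitmx.
Qed.

Lemma mu_eq0 (R : realType) (m p n : nat) (G : 'M[R]_(m, p)) (S : 'M[R]_(p, n)) :
  (forall A, Omega S A -> A = 0) -> mu G S = 0.
Proof.
move=> O0; apply/eqP; rewrite eq_le mu_ge0 andbT; apply: ge_sup.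
  exists (spectral_norm (G *m (0 : 'M_(p, n)))), 0 => //; split.
    by move=> i j; rewrite mxE eqxx.
  by apply/norm_max_leP => // i j; rewrite mxE normr0.
move=> _ [A [/O0 -> _] <-]; apply/spectral_norm_leP => // y x.
by rewrite mulmx0 mul0mx frob0r mulr0 mul0r.
Qed.

Theorem theorem3p4 (R : realType) (m p n : nat)
  (H : 'M[R]_(m, p)) (S0 : 'M[R]_(p, n)) (L0 : 'M[R]_(m, n))
  (U : 'M[R]_(m, \rank H)) (Sigma : 'M[R]_(\rank H)) (V : 'M[R]_(p, \rank H))
  (svdH : reduced_svd H U Sigma V) :
  let M0 := H *m S0 + L0 in
  let C := U *m invmx Sigma *m U^T in
  let Ht := C *m H in
  (exists delta : R,
    [/\ delta < 1 / 3%:R,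
        (forall A : 'M[R]_(p, n), Omega S0 A ->
           norm_max (ker_proj H *m A) <= delta * norm_max A)
      & mu Ht S0 * xi Ht (C *m L0) < (1 - 3%:R * delta) / 6%:R]) ->
  exists gamma : R, 0 < gamma /\
    forall (Sc : 'M[R]_(p, n)) (Y : 'M[R]_(m, n)),
      optimizer gamma Ht (C *m M0) Sc Y ->
      Sc = S0 /\ M0 - H *m Sc = L0.
Proof.
move=> M0 C G [delta0 [_ K_small0 inc0]].
have [delta [delta_ge0 K_small incoherent]] : exists delta, [/\ 0 <= delta,
    forall A : 'M[R]_(p, n), Omega S0 A -> norm_max (ker_proj H *m A) <= delta * norm_max A
    & mu G S0 * xi G (C *m L0) < (1 - 3 * delta) / 6].
  (* A negative delta is only possible when Omega(S0) is trivial; then mu = 0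
     and delta = 0 serves as well. *)
  have [d0|d0] := leP 0 delta0; first by exists delta0.
  have O0 A : Omega S0 A -> A = 0.
    move=> /K_small0 /(le_trans (norm_max_ge0 _)) h.
    by apply: mx_norm_eq0; apply/eqP; rewrite eq_le norm_max_ge0 andbT -(nmulr_rge0 _ d0).
  exists 0; split=> // [A /O0 ->|].
    by rewrite mul0r mulmx0; apply/norm_max_leP => // i j; rewrite mxE normr0.
  by rewrite (mu_eq0 G O0) mul0r; lra.
have [UL [SL [VL [svdL nucL _]]]] := svd_exists (C *m L0).
have GE : G = U *m V^T := polar_factor svdH.
have [U1 _ _ _] := svdH.
have GG : G^T *m G = 1%:M - ker_proj H.
  rewrite (ker_proj_svd svdH) opprB addrC subrK GE trmx_mul trmxK mulmxA -(mulmxA V) U1.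
  by rewrite mulmx1.
have [gamma [gamma0 gamma_xi gamma_mu]] := incoherent_gamma_exists delta_ge0 incoherent.
exists gamma; split=> // Sc Y opt.
have SE : Sc = S0.
  have rec := incoherent_recovery svdL nucL GG delta_ge0 K_small incoherent
    gamma0 gamma_xi gamma_mu.
  apply: (rec Sc Y).
  by move: opt; rewrite /M0 mulmxDr addrC mulmxA.
by split; rewrite ?SE// /M0 addrC addKr.
Qed.
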